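(* Let $G$ be a graph with maximum degree $\Delta \geq 4$. If $\mathrm{mad}(G) < \frac{14}{5}$, then $\chi_i(G) \leq \Delta + 2$.
   Context: All graphs are finite and simple. For a graph $G$, $\mathrm{mad}(G)$ denotes the maximum average degree of $G$, i.e. the maximum of $2|E(H)|/|V(H)|$ over all nonempty subgraphs $H$ of $G$. An injective coloring of $G$ is an assignment of colors to the vertices of $G$ such that any two vertices having a common neighbor receive distinct colors (adjacent vertices need not receive distinct colors unless they have a common neighbor). The injective chromatic number $\chi_i(G)$ is the minimum number of colors in an injective coloring of $G$. $\Delta$ denotes the maximum degree of $G$. *)

(* Defs.v *)
(* A finite simple graph is a symmetric irreflexive relation [e : rel T] on its
   finite vertex type [T]. *)
From mathcomp Require Import all_boot all_order all_algebra.

Set Implicit Arguments.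
Unset Strict Implicit.
Unset Printing Implicit Defensive.

Import Order.TTheory GRing.Theory Num.Theory.

Definition edges (T : finType) (e : rel T) : {set {set T}} :=
  [set [set x; y] | x in T, y in T & e x y].

Definition degree (T : finType) (e : rel T) (v : T) : nat :=
  #|[set w | e v w]|.

Definition max_degree (T : finType) (e : rel T) : nat :=
  \max_(v : T) degree e v.

(* A subgraph, not necessarily induced, is a pair of a set of vertices and a
   set of edges of the ambient graph with all their endpoints among those
   vertices. *)
Definition is_subgraph (T : finType) (e : rel T)
    (H : {set T} * {set {set T}}) : bool :=
  (H.2 \subset edges e) && [forall f in H.2, f \subset H.1].

Definition average_degree (T : finType) (H : {set T} * {set {set T}}) : rat :=
  (2 * #|H.2|%:R / #|H.1|%:R)%R.

(* Average degrees are nonnegative, so the neutral value 0 only matters for the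
   graph with no vertices. *)
Definition mad (T : finType) (e : rel T) : rat :=
  \big[Num.max/0%R]_(H : {set T} * {set {set T}} |
                      is_subgraph e H && (H.1 != set0)) average_degree H.

Definition injective_coloring (T : finType) (e : rel T) (k : nat)
    (c : {ffun T -> 'I_k}) : bool :=
  [forall x, forall y,
    (x != y) && [exists z, e x z && e y z] ==> (c x != c y)].

Definition injective_colorable (T : finType) (e : rel T) (k : nat) : bool :=
  [exists c : {ffun T -> 'I_k}, injective_coloring e c].

Lemma ex_injective_colorable (T : finType) (e : rel T) :
  exists k, injective_colorable e k.
Proof.
exists #|T|; apply/existsP; exists [ffun x => enum_rank x].
apply/forallP=> x; apply/forallP=> y; apply/implyP=> /andP[neq_xy _].
by rewrite !ffunE (inj_eq enum_rank_inj).
Qed.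

Definition injective_chromatic_number (T : finType) (e : rel T) : nat :=
  ex_minn (ex_injective_colorable e).

(* Main.v *)
(** A minimal counterexample is compared with the set [U] obtained by uncoloring,
    one after the other, every vertex with at most [D + 1] conflicts outside the
    vertices already uncolored: [U] can always be recolored greedily, so no edge
    has both ends in [U], while a vertex outside [U] has at least [D + 2]
    conflicts outside [U].

    Let [S] be the set of the 2-vertices outside [U] that have a neighbor of
    degree 4 in [U]. Regard them as the edges of a graph [M] joining their two
    neighbors. They have exactly as many conflicts outside [U] as there are
    colors, so coloring them is list-coloring the edges of [M] with as many
    colors as adjacent edges. If [M] has more edges than vertices, then this is
    possible for some nonempty part of [M], because, after coloring some edges, a
    component becomes a cycle with one pendant edge or with one chord. So [M] has
    at most as many edges as vertices.

    Finally every vertex [v] gets the charge [5 d(v) - 14 + (d_M(v) - 2)], the last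
    summand only if [v] is a vertex of [M]. Vertices send 2 to each neighbor of
    degree 2, and those of degree at least 4 send 1 to each neighbor of degree 3
    with a neighbor of degree 2. All charges become nonnegative, which
    contradicts the bound [14/5] on the average degree. *)
Require Import Defs.
From mathcomp Require Import all_boot all_order all_algebra.
From mathcomp Require Import zify.

Set Implicit Arguments.
Unset Strict Implicit.
Unset Printing Implicit Defensive.

Import Order.TTheory GRing.Theory Num.Theory.

(** * Extending partial proper colorings of a graph *)

Section Extension.

Variables (T : finType) (f : rel T) (k : nat).
Hypotheses (f_sym : symmetric f) (f_irr : irreflexive f).
Implicit Types (A B K X Y : {set T}) (c : T -> 'I_k).

Definition nbrs_in X x := [set y in X | f x y].

(** A partial coloring is a total function whose values outside the colored set are ignored. *)
Definition proper_on c X := forall x y, x \in X -> y \in X -> f x y -> c x != c y.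

Definition extends X Y := forall c, proper_on c X ->
  exists2 c', proper_on c' Y & {in X, c' =1 c}.

Lemma proper_onS c X Y : X \subset Y -> proper_on c Y -> proper_on c X.
Proof. by move=> /subsetP sXY pc x y /sXY xY /sXY; apply: pc. Qed.

Lemma extends_trans X Y Z :
  X \subset Y -> extends X Y -> extends Y Z -> extends X Z.
Proof.
move=> /subsetP sXY eXY eYZ c /eXY[c1 /eYZ[c2 pc2 e2] e1].
by exists c2 => // x xX; rewrite e2 ?e1 ?sXY.
Qed.

Lemma extend_with c X b a : proper_on c X -> b \notin X ->
    a \notin [set c y | y in nbrs_in X b] ->
  exists c', [/\ proper_on c' (b |: X), {in X, c' =1 c} & c' b = a].
Proof.
move=> pc bX aP; exists (fun x => if x == b then a else c x).
have ne z : z \in X -> (z == b) = false.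
  by move=> zX; apply: contraNF bX => /eqP <-.
split=> [x y|x xX|]; last 2 first.
- by rewrite ne.
- by rewrite eqxx.
have aN z : z \in X -> f b z -> a != c z.
  move=> zX fbz; apply: contraNneq aP => ->.
  by apply/imsetP; exists z; rewrite // inE zX.
rewrite !in_setU1 => /orP[/eqP->|xX] /orP[/eqP->|yX].
- by rewrite f_irr.
- by rewrite eqxx (ne y) //; apply: aN.
- by rewrite eqxx (ne x) // f_sym eq_sym; apply: aN.
- by rewrite !ne //; apply: pc.
Qed.

Lemma free_color (Q : {set 'I_k}) : #|Q| < k -> exists a, a \notin Q.
Proof.
move=> Qk; have : 0 < #|~: Q| by move: (cardsC Q); rewrite card_ord; lia.
by case/card_gt0P => a; rewrite inE; exists a.
Qed.

Lemma extends1 X b : b \notin X -> #|nbrs_in X b| < k -> extends X (b |: X).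
Proof.
move=> bX lt_k c pc.
have [|a aP] := @free_color [set c y | y in nbrs_in X b].
  exact: leq_ltn_trans (leq_imset_card _ _) lt_k.
by have [c' [pc' ec' _]] := extend_with pc bX aP; exists c'.
Qed.

(** Phrased with closed subsets instead of paths; the empty set counts as connected. *)
Definition connected K := forall A, A \subset K -> A != set0 ->
  (forall a b, a \in A -> b \in K -> f a b -> b \in A) -> A = K.

Lemma connected_grow K B : connected K -> B \subset K -> B != set0 -> B != K ->
  exists a b, [/\ a \in B, b \in K, b \notin B & f a b].
Proof.
move=> cK sBK B0 BK.
case E: [exists a, exists b, [&& a \in B, b \in K, b \notin B & f a b]].
  have /existsP[a /existsP[b /and4P[]]] := E; by exists a, b.
case/eqP: BK; apply: cK => // a b aB bK fab; apply: contraFT E => bB.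
by apply/existsP; exists a; apply/existsP; exists b; apply/and4P.
Qed.

Lemma card_nbrs_inS X Y x : X \subset Y -> #|nbrs_in X x| <= #|nbrs_in Y x|.
Proof.
move=> /subsetP sXY; apply: subset_leq_card; apply/subsetP=> y.
by rewrite !inE => /andP[/sXY-> ->].
Qed.

Lemma card_nbrs_in_lt X Y x y :
  X \subset Y -> y \in Y -> y \notin X -> f x y ->
  #|nbrs_in X x| < #|nbrs_in Y x|.
Proof.
move=> /subsetP sXY yY yX fxy; apply: proper_card; apply/properP; split.
  by apply/subsetP=> z; rewrite !inE => /andP[/sXY-> ->].
by exists y; rewrite !inE ?yY // (negPf yX).
Qed.

Lemma card_nbrs_inU X Y x : [disjoint X & Y] ->
  #|nbrs_in (X :|: Y) x| = #|nbrs_in X x| + #|nbrs_in Y x|.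
Proof.
move=> dXY; have -> : nbrs_in (X :|: Y) x = nbrs_in X x :|: nbrs_in Y x.
  by apply/setP=> y; rewrite !inE andb_orl.
apply/eqP; rewrite (leq_card_setU (nbrs_in X x) (nbrs_in Y x)).
apply/pred0P=> y /=; rewrite !inE.
have := pred0P dXY y; rewrite /= => /andP.
by case: (y \in X); case: (y \in Y) => //=; rewrite ?andbF //; case.
Qed.

(* The vertices of [K] are colored from the ones farthest from [p] to [p], so
   that each of them but [p] still has an uncolored neighbor. *)
Lemma extends_slack c X K p :
    [disjoint X & K] -> connected K -> p \in K ->
    {in K, forall u, #|nbrs_in (X :|: K) u| <= k} ->
    proper_on c X ->
    #|[set c y | y in nbrs_in X p]| + #|nbrs_in K p| < k ->
  exists2 c', proper_on c' (X :|: K) & {in X, c' =1 c}.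
Proof.
move=> dXK cK pK leK pc slack.
(* [E B] says that [B] may be colored last. [B] grows from [p] alone to all of [K]. *)
pose E B := forall c', proper_on c' (X :|: (K :\: B)) -> {in X, c' =1 c} ->
  exists2 c'', proper_on c'' (X :|: K) & {in X, c'' =1 c}.
have XF z : z \in K -> (z \in X) = false.
  by move=> zK; have := pred0P dXK z; rewrite /= zK andbT.
suff EK : E K by apply: (EK c) => //; rewrite setDv setU0.
have Ep : E [set p].
  move=> c' pc' ec'.
  have pX : p \notin X :|: K :\: [set p] by rewrite !inE eqxx XF.
  have [|a aP] := @free_color [set c' y | y in nbrs_in (X :|: K :\: [set p]) p].
    apply: leq_ltn_trans slack.
    have -> : nbrs_in (X :|: K :\: [set p]) p = nbrs_in X p :|: nbrs_in (K :\ p) p.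
      by apply/setP=> y; rewrite !inE andb_orl.
    rewrite imsetU.
    have -> : c' @: nbrs_in X p = c @: nbrs_in X p.
      by apply: eq_in_imset => y; rewrite inE => /andP[/ec'].
    apply: leq_trans (leq_card_setU _ _).1 _; rewrite leq_add2l.
    apply: leq_trans (leq_imset_card _ _) _.
    by apply: card_nbrs_inS; apply: subsetDl.
  have [c'' [pc'' ec'' _]] := extend_with pc' pX aP; exists c''.
    apply: proper_onS pc''; apply/subsetP=> z; rewrite !inE.
    by case: (z == p) => //=.
  by move=> x xX; rewrite ec'' ?ec' // inE xX.
have: [set p] \subset K by rewrite sub1set.
have: [set p] != set0 by apply/set0Pn; exists p; rewrite inE.
have [n] := ubnP #|K :\: [set p]|.
elim: n [set p] Ep => // n IHn B EB leB B0 sBK.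
have [->//|BK] := eqVneq K B.
have [a [b [aB bK bB fab]]] := connected_grow cK sBK B0 (contra_neq esym BK).
apply: (IHn (b |: B)).
- move=> c' pc' ec'.
  have bX : b \notin X :|: K :\: (b |: B) by rewrite !inE eqxx XF.
  have lt_k : #|nbrs_in (X :|: K :\: (b |: B)) b| < k.
    apply: leq_trans (leK b bK); apply: (@card_nbrs_in_lt _ _ _ a).
    + by apply: setUS; apply: subsetDl.
    + by rewrite inE (subsetP sBK) ?orbT.
    + by rewrite !inE aB orbT XF // (subsetP sBK).
    + by rewrite f_sym.
  have [c'' pc'' ec''] := extends1 bX lt_k pc'.
  apply: (EB c'').
    apply: proper_onS pc''; apply/subsetP=> z; rewrite !inE.
    by case: (z == b).
  by move=> x xX; rewrite ec'' ?ec' // inE xX.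
- rewrite -ltnS; apply: leq_trans leB; rewrite ltnS.
  apply: proper_card; apply/properP; split.
    by apply: setDS; apply: subsetU1.
  by exists b; rewrite !inE ?eqxx ?bK ?bB.
- by apply/set0Pn; exists b; rewrite !inE eqxx.
- by rewrite subUset sub1set bK.
Qed.

(* A color available at [u] but not at [p] leaves [p] with a spare color. *)
Lemma extends_uneven X K u p :
    [disjoint X & K] -> connected (K :\ u) -> u \in K -> p \in K -> f u p ->
    {in K, forall v, #|nbrs_in (X :|: K) v| <= k} ->
    #|nbrs_in K p| < #|nbrs_in K u| ->
  extends X (X :|: K).
Proof.
move=> dXK cK uK pK fup leK lt_pu c pc.
have XF z : z \in K -> (z \in X) = false.
  by move=> zK; have := pred0P dXK z; rewrite /= zK andbT.
have neq_pu : p != u by apply: contraTneq fup => ->; rewrite f_irr.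
have ltKu : #|nbrs_in (K :\ u) p| < #|nbrs_in K p|.
  apply: (@card_nbrs_in_lt _ _ _ u) => //; first exact: subsetDl.
    by rewrite !inE eqxx.
  by rewrite f_sym.
have := leK p pK; have := leK u uK; rewrite !card_nbrs_inU // => leu lep.
set CU := c @: nbrs_in X u; set CP := c @: nbrs_in X p.
have leCU : #|CU| <= #|nbrs_in X u| by apply: leq_imset_card.
have leCP : #|CP| <= #|nbrs_in X p| by apply: leq_imset_card.
have [a [aU aP]] : exists a, a \notin CU /\ #|a |: CP| + #|nbrs_in (K :\ u) p| < k.
  (* A color of [CP] that is free at [u] adds nothing to the colors around [p]. If there is none,
     [p] sees at most as many colors as [u] has neighbors in [X], and any color free at [u] will do,
     since [u] has more neighbors in [K] than [p]. *)
  have [sPU|/subsetPn[a aP aU]] := boolP (CP \subset CU).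
    have [|a aU] := @free_color CU; first by apply: leq_ltn_trans leCU _; lia.
    exists a; split=> //.
    apply: (@leq_ltn_trans (1 + #|nbrs_in X u| + #|nbrs_in (K :\ u) p|)); last lia.
    rewrite leq_add2r cardsU1 leq_add ?leq_b1 //.
    exact: leq_trans (subset_leq_card sPU) leCU.
  exists a; split=> //; rewrite (setUidPr _) ?sub1set //.
  by apply: leq_ltn_trans (leq_add leCP (leqnn _)) _; lia.
have [c1 [pc1 ec1 c1u]] := extend_with pc (negbT (XF u uK)) aU.
have U : (u |: X) :|: (K :\ u) = X :|: K.
  by apply/setP=> z; rewrite !inE; case: eqP => // ->; rewrite uK orbT.
have [||||c2 pc2 ec2] := @extends_slack c1 (u |: X) (K :\ u) p _ cK _ _ pc1.
- apply/pred0P=> z /=; rewrite !inE; case: eqP => //= _.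
  by case: (boolP (z \in K)) => [/XF->|]; rewrite ?andbF.
- by rewrite !inE neq_pu.
- by move=> v; rewrite !inE U => /andP[_ /leK].
- apply: leq_ltn_trans aP; rewrite leq_add2r; apply: subset_leq_card.
  apply/subsetP=> _ /imsetP[y + ->]; rewrite !inE => /andP[/orP[/eqP->|yX] fpy].
    by rewrite c1u eqxx.
  by rewrite ec1 // imset_f ?orbT // inE yX.
exists c2; first by rewrite -U.
by move=> x xX; rewrite ec2 ?ec1 // !inE xX orbT.
Qed.

Lemma connectedU1 K b a : connected K -> a \in K -> f a b -> connected (b |: K).
Proof.
move=> cK aK fab A sA A0 clA.
have closed : forall x y, x \in A :&: K -> y \in K -> f x y -> y \in A :&: K.
  move=> x y /setIP[xA xK] yK fxy; rewrite inE yK andbT.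
  by apply: clA fxy => //; rewrite inE yK orbT.
have aA : a \in A.
  have [E|nE] := eqVneq (A :&: K) set0; last first.
    by have := aK; rewrite -(cK _ (subsetIr _ _) nE closed) inE => /andP[].
  have /set0Pn[z zA] := A0; have := subsetP sA z zA; rewrite !inE.
  case/orP=> [/eqP zb|zK].
    by apply: (clA z); rewrite ?inE ?aK ?orbT // zb f_sym.
  by have := in_set0 z; rewrite -E inE zA zK.
have AK : A :&: K = K.
  by apply: cK closed; [exact: subsetIr|apply/set0Pn; exists a; rewrite inE aA].
apply/eqP; rewrite eqEsubset sA subUset sub1set.
by rewrite (clA _ _ aA _ fab) ?inE ?eqxx //= -AK subsetIl.
Qed.

End Extension.

(** When [K] is built up from one vertex through connected sets, the last vertex added can be
    removed. *)
Lemma connected_noncut (T : finType) (f : rel T) (K : {set T}) :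
  symmetric f -> connected f K -> 1 < #|K| ->
  exists2 u, u \in K & connected f (K :\ u).
Proof.
move=> f_sym cK K1; have [a aK] : exists a, a \in K by apply/card_gt0P; lia.
have : connected f [set a].
  move=> A; rewrite subset1 => /orP[/eqP->//|/eqP->]; by rewrite eqxx.
have : [set a] != set0 by rewrite -card_gt0 cards1.
have : [set a] \proper K by rewrite properEcard sub1set aK cards1.
have [n] := ubnP #|K :\: [set a]|.
elim: n [set a] => // n IHn B leB prB B0 cB.
have [sBK nBK] := (proper_sub prB, proper_neq prB).
have [x [y [xB yK yB fxy]]] := connected_grow cK sBK B0 nBK.
have cyB : connected f (y |: B) by apply: connectedU1 xB _; rewrite // f_sym.
have [<-|neK] := eqVneq (y |: B) K.
  by exists y; rewrite ?setU11 // setU1K.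
apply: (IHn (y |: B)) => //.
- rewrite -ltnS; apply: leq_trans leB; rewrite ltnS.
  apply: proper_card; apply/properP; split.
    by apply: setDS; apply: subsetU1.
  by exists y; rewrite !inE ?eqxx ?yK ?yB.
- by rewrite properEneq neK subUset sub1set yK.
- by apply/set0Pn; exists y; rewrite !inE eqxx.
Qed.

(** The graph whose proper colorings are the injective colorings of [e]. *)
Definition conflict (T : finType) (e : rel T) : rel T :=
  fun x y => (x != y) && [exists z, e x z && e y z].

(** * Line graphs: coloring the edges of a graph *)

Section LineGraph.

Variables (T : finType) (e : rel T).
Hypothesis e_sym : symmetric e.
Implicit Types (A K V X : {set T}).

Let f := conflict e.
Let N x := [set w | e x w].
Let d K x := #|nbrs_in e K x|.

Lemma conflict_sym : symmetric (conflict e).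
Proof.
move=> x y; rewrite /conflict eq_sym; congr (_ && _).
by apply: eq_existsb => z; rewrite andbC.
Qed.

Lemma conflict_irr : irreflexive (conflict e).
Proof. by move=> x; rewrite /conflict eqxx. Qed.

Lemma conflictI z x y : x != y -> e x z -> e y z -> conflict e x y.
Proof. by rewrite /conflict => -> xz yz; apply/existsP; exists z; rewrite xz. Qed.

Lemma conflictE x y :
  conflict e x y -> exists z, [/\ x != y, e x z & e y z].
Proof. by case/andP=> ? /existsP[z /andP[? ?]]; exists z. Qed.

(* The elements of a thin set are the edges of a simple graph on [T], the ends
   of [u] being its two neighbors; [conflict e] is adjacency in its line graph
   and [d K x] is the degree of [x] in the subgraph with edge set [K]. *)
Definition thin K :=
  {in K, forall u, degree e u = 2} /\
  {in K &, forall u v, [set w | e u w] = [set w | e v w] -> u = v}.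

Definition ends K := [set x | 0 < #|nbrs_in e K x|].

Lemma thinS A K : A \subset K -> thin K -> thin A.
Proof.
move=> /subsetP sAK [K2 Ki]; split=> [u /sAK/K2//|u v /sAK uK /sAK vK].
exact: Ki.
Qed.

Lemma degree2_ends u x : degree e u = 2 -> e x u ->
  exists y, [/\ y != x, N u = [set x; y] & e y u].
Proof.
move=> du xu; have /cards2P[a [b [neq_ab E]]] : #|N u| == 2 by rewrite -du.
have : x \in [set a; b] by rewrite -E inE e_sym.
have : a \in N u by rewrite E !inE eqxx.
have : b \in N u by rewrite E !inE eqxx orbT.
rewrite !inE !(e_sym u) => bu au /orP[/eqP xE|/eqP xE]; subst x.
  by exists b; split; [rewrite eq_sym|exact: E|].
by exists a; split; [|rewrite setUC|].
Qed.

Lemma thin_ends K u x : thin K -> u \in K -> e x u ->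
  exists y, [/\ y != x, N u = [set x; y] & e y u].
Proof. by move=> [K2 _] /K2; apply: degree2_ends. Qed.

Lemma in_ends2 u x y z : N u = [set x; y] -> e z u = (z == x) || (z == y).
Proof. by move=> E; have := in_set2 z x y; rewrite -E inE e_sym. Qed.

Lemma handshake K : thin K -> \sum_x d K x = 2 * #|K|.
Proof.
move=> [K2 _]; under eq_bigr do rewrite /d -sum1_card.
rewrite (exchange_big_dep (mem K)) /=; last first.
  by move=> x u _; rewrite inE => /andP[].
rewrite mulnC -sum_nat_const; apply: eq_bigr => u uK.
rewrite -(K2 u uK) sum1dep_card; apply: eq_card => x.
by rewrite !inE uK e_sym.
Qed.

(** The other edges at [x] and the other edges at [y] do not overlap, since a thin set has no
    parallel edges. *)
Lemma line_degree K u x y : thin K -> u \in K -> x != y -> N u = [set x; y] ->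
  #|nbrs_in f K u| + 2 = d K x + d K y.
Proof.
move=> thK uK neq_xy E; have [K2 Ki] := thK.
have [xu yu] : e x u /\ e y u.
  by rewrite !(in_ends2 _ E) !eqxx orbT.
have D1 z : e z u -> d K z = #|nbrs_in e (K :\ u) z| + 1.
  move=> zu; rewrite addn1 /d (cardsD1 u) inE uK zu /= add1n; congr _.+1.
  by apply: eq_card => v; rewrite !inE andbA.
rewrite !D1 // addnACA; congr (_ + _).
have -> : nbrs_in f K u = nbrs_in e (K :\ u) x :|: nbrs_in e (K :\ u) y.
  apply/setP=> v; rewrite !inE; apply/andP/orP.
    move=> [vK /conflictE[z [nuv]]]; rewrite e_sym (in_ends2 _ E) => zE vz.
    case/orP: zE vz => /eqP->; rewrite e_sym => ->; [left|right];
      by rewrite eq_sym nuv vK.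
  case=> /andP[/andP[nvu vK] zv]; split=> //; rewrite eq_sym in nvu.
    by apply: (@conflictI x); rewrite // e_sym.
  by apply: (@conflictI y); rewrite // e_sym.
apply/eqP; rewrite (leq_card_setU (nbrs_in e (K :\ u) x)).
apply/pred0P=> v /=; rewrite !inE.
apply/negP=> /andP[/andP[/andP[nvu vK] xv] /andP[_ yv]].
case/eqP: nvu; apply: Ki => //.
have [y' [ny'x E' _]] := thin_ends thK vK xv.
move: yv; rewrite (in_ends2 _ E') eq_sym (negPf neq_xy) /= => /eqP yy'.
by rewrite -/(N v) -/(N u) E E' yy'.
Qed.

Lemma degreeD1 K u x : u \in K -> d K x = d (K :\ u) x + e x u.
Proof.
move=> uK; rewrite /d addnC (cardsD1 u) inE uK; congr (_ + _).
by apply: eq_card => v; rewrite !inE andbA.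
Qed.

Lemma degree_gt0 K u x : u \in K -> e x u -> 0 < d K x.
Proof. by move=> uK xu; apply/card_gt0P; exists u; rewrite inE uK. Qed.

Lemma degree_gt0P K x : 0 < d K x -> exists2 u, u \in K & e x u.
Proof. by case/card_gt0P=> u; rewrite inE => /andP[]; exists u. Qed.

Lemma endsS A K : A \subset K -> ends A \subset ends K.
Proof.
move=> sAK; apply/subsetP=> x; rewrite !inE => /leq_trans; apply.
exact: card_nbrs_inS.
Qed.

Lemma sum_ends K V : ends K \subset V -> \sum_(x in V) d K x = \sum_x d K x.
Proof.
move=> /subsetP sV; rewrite [RHS](bigID (mem V)) /= [X in _ + X]big1 ?addn0 //.
move=> x; apply: contraNeq; rewrite -lt0n => dx; apply: sV; by rewrite inE.
Qed.

(** The degrees sum to [2 * #|K|], at least twice the size of [V], so none may fall below 2. *)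
Lemma degree_eq2 K V : thin K -> ends K \subset V -> #|V| <= #|K| ->
  (forall x, d K x <= 2) -> {in V, forall x, d K x = 2}.
Proof.
move=> thK sV leV le2 x xV; have := handshake thK; rewrite -(sum_ends sV) => E.
have : \sum_(y in V) (2 - d K y) = 0.
  have : \sum_(y in V) d K y + \sum_(y in V) (2 - d K y) = #|V| * 2.
    rewrite -big_split -sum_nat_const; apply: eq_bigr => y _ /=.
    by rewrite subnKC.
  by rewrite E; lia.
move/eqP; rewrite sum_nat_eq0 => /forall_inP/(_ x xV)/eqP.
by have := le2 x; lia.
Qed.

(* If [A] contained the edges at just one end of [u], that end would be the only
   vertex of odd degree in [A]. *)
Lemma connectedD1_even K u : thin K -> connected f K ->
  (forall x, ~~ odd (d K x)) -> u \in K -> connected f (K :\ u).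
Proof.
move=> thK cK ev uK A sA A0 clA.
have [sAK uA] : A \subset K /\ u \notin A.
  split; first exact: subset_trans sA (subsetDl _ _).
  by apply/negP=> /(subsetP sA); rewrite !inE eqxx.
have thA := thinS sAK thK.
have [K2 _] := thK.
have /cards2P[x [y [nxy E]]] : #|N u| == 2 by rewrite -(K2 u uK).
have EV z : e z u = (z == x) || (z == y) by apply: in_ends2.
(* [A] is closed in [K :\ u], so wherever it has one edge it has all of them but [u]. *)
have full z : 0 < d A z -> d A z = d (K :\ u) z.
  case/degree_gt0P=> a aA za; apply: eq_card => v; rewrite inE [RHS]inE.
  apply: andb_id2r => zv; apply/idP/idP => [/(subsetP sA)//|vK].
  have [->//|nav] := eqVneq v a; apply: (clA a) => //.
  by apply: (@conflictI z); rewrite 1?eq_sym // e_sym.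
have evA z : z != x -> z != y -> ~~ odd (d A z).
  move=> zx zy; case: (posnP (d A z)) => [->//|/full->].
  by move: (ev z); rewrite (degreeD1 z uK) EV (negPf zx) (negPf zy) addn0.
have odA z : e z u -> odd (d A z) = (0 < d A z).
  move=> zu; case: (posnP (d A z)) => [->//|/full->].
  by have := ev z; rewrite (degreeD1 z uK) zu addn1 /= negbK.
have both : (0 < d A x) = (0 < d A y).
  have : ~~ odd (\sum_z d A z) by rewrite handshake // mul2n odd_double.
  rewrite (bigD1 x) //= (bigD1 y) 1?eq_sym //= !oddD !odA ?EV ?eqxx ?orbT //.
  suff -> : odd (\sum_(i | (i != x) && (i != y)) d A i) = false.
    by rewrite addbF; do 2!case: (0 < _).
  apply/negbTE; elim/big_ind: _ => // [a b|z /andP[]]; last exact: evA.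
  by rewrite oddD => /negPf-> /negPf->.
have atu a : a \in A -> f a u -> 0 < d A x.
  move=> aA /conflictE[z [_]]; rewrite e_sym (e_sym u) EV => za zE.
  by case/orP: zE za => /eqP-> za; [|rewrite both]; apply: degree_gt0 aA za.
(* If [A] misses both ends of [u], it is closed in [K], hence equal to [K]. Otherwise it touches
   both, and [u |: A] is closed in [K]. *)
case: (posnP (d A x)) => [dx0|dx].
  suff AK : A = K by rewrite AK uK in uA.
  apply: cK => // a b aA bK fab; apply: (clA a) => //.
  rewrite !inE bK andbT; apply: contraTneq fab => ->.
  by apply/negP=> /(atu a aA); rewrite dx0.
have -> : K = u |: A.
  apply/esym; apply: cK.
  - by rewrite subUset sub1set uK.
  - by apply/set0Pn; exists u; rewrite setU11.
  move=> a b; rewrite !in_setU1 => /orP[/eqP->|aA] bK fab.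
    have [->//|nbu /=] := eqVneq b u.
    have [z [_]] := conflictE fab; rewrite e_sym EV => zE bz.
    have /degree_gt0P[a' a'A za'] : 0 < d A z.
      by case/orP: zE => /eqP->; [|rewrite -both].
    have [->//|na'b] := eqVneq b a'; apply: (clA a'); rewrite ?inE ?nbu //.
    by apply: (@conflictI z); rewrite 1?eq_sym // e_sym.
  have [->//|nbu /=] := eqVneq b u.
  by apply: (clA a); rewrite ?inE ?nbu.
by rewrite setU1K.
Qed.

(** All edges adjacent to [p] meet it at its end other than [q], where they are adjacent to each
    other anyway. *)
Lemma connectedD1_leaf K p q : thin K -> connected f K -> p \in K ->
  e q p -> d K q = 1 -> connected f (K :\ p).
Proof.
move=> thK cK pK qp dq A sA A0 clA.
have [sAK pA] : A \subset K /\ p \notin A.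
  split; first exact: subset_trans sA (subsetDl _ _).
  by apply/negP=> /(subsetP sA); rewrite !inE eqxx.
have only v : v \in K -> e q v -> v = p.
  move=> vK qv; apply/eqP; apply: contraTT isT => nvp.
  have : 0 < d (K :\ p) q by apply: degree_gt0 qv; rewrite !inE nvp.
  by have := degreeD1 q pK; rewrite dq qp addn1 => - [<-].
have [r [nrq Ep rp]] := thin_ends thK pK qp.
have atr b : b \in K -> f p b -> e r b.
  move=> bK /conflictE[z [npb]]; rewrite e_sym (in_ends2 _ Ep) => zE bz.
  case/orP: zE bz => /eqP->; rewrite e_sym // => /(only b bK) bp.
  by rewrite bp eqxx in npb.
case: (posnP (d A r)) => [dr0|/degree_gt0P[a aA ra]].
  suff AK : A = K by rewrite AK pK in pA.
  apply: cK => // a b aA bK fab; apply: (clA a) => //.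
  rewrite !inE bK andbT; apply: contraTneq fab => ->.
  rewrite /f conflict_sym; apply/negP=> /(atr a (subsetP sAK a aA)) ra.
  by have := degree_gt0 aA ra; rewrite -/(d A r) dr0.
have -> : K = p |: A.
  apply/esym; apply: cK.
  - by rewrite subUset sub1set pK.
  - by apply/set0Pn; exists p; rewrite setU11.
  move=> x b; rewrite !in_setU1 => /orP[/eqP->|xA] bK fxb.
    have [->//|nbp /=] := eqVneq b p; have [->//|nba] := eqVneq b a.
    apply: (clA a); rewrite ?inE ?nbp //.
    by apply: (@conflictI r); rewrite 1?eq_sym // e_sym //; apply: atr.
  have [->//|nbp /=] := eqVneq b p.
  by apply: (clA x); rewrite ?inE ?nbp.
by rewrite setU1K.
Qed.

(** Induction on the size of [K]. An edge whose removal keeps the hypotheses can be colored first,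
    since it has an uncolored neighbor. The candidate is a pendant edge or, if there is none, an
    edge whose removal does not disconnect [K]. If its removal leaves no degree above 2, what
    remains is a cycle, and [extends_uneven] applies. *)
Lemma extends_cyclic k K X : thin K -> connected f K ->
    #|ends K| <= #|K| -> (exists x, 2 < d K x) -> [disjoint X & K] ->
    {in K, forall u, #|nbrs_in f (X :|: K) u| <= k} ->
  extends f k X (X :|: K).
Proof.
have [n] := ubnP #|K|; elim: n K X => // n IHn K X leK.
move=> thK cK leV [x0 dx0] dXK lek.
have f_sym := @conflict_sym; have f_irr := conflict_irr.
have K2 : 2 < #|K|.
  apply: leq_trans dx0 _; apply: subset_leq_card; apply/subsetP=> z.
  by rewrite inE => /andP[].
have mate u : u \in K -> exists2 w, w \in K & f u w.
  move=> uK; have [||||a [b [/set1P-> bK _ fub]]] := @connected_grow _ f K [set u].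
  - exact: cK.
  - by rewrite sub1set.
  - by rewrite -card_gt0 cards1.
  - by apply: contraTneq K2 => <-; rewrite cards1.
  by exists b.
have step u : u \in K -> connected f (K :\ u) ->
    #|ends (K :\ u)| <= #|K :\ u| -> (exists x, 2 < d (K :\ u) x) ->
    extends f k X (X :|: K).
  move=> uK cKu leVu dKu; have [w wK fuw] := mate u uK.
  have uX : u \notin X by have := pred0P dXK u; rewrite /= uK andbT => ->.
  have U : (u |: X) :|: (K :\ u) = X :|: K.
    by apply/setP=> z; rewrite !inE; case: eqP => // ->; rewrite uK orbT.
  apply: (@extends_trans _ _ _ _ (u |: X)); first exact: subsetU1.
    apply: extends1 => //; apply: leq_trans (lek u uK).
    apply: (@card_nbrs_in_lt _ _ _ _ _ w) => //; first exact: subsetUl.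
      by rewrite inE wK orbT.
    by have := pred0P dXK w; rewrite /= wK andbT => ->.
  rewrite -U; apply: IHn => //.
  - by have := cardsD1 u K; rewrite uK; lia.
  - exact: thinS (subsetDl _ _) thK.
  - apply/pred0P=> z /=; rewrite !inE; case: eqP => //= _.
    exact: (pred0P dXK z).
  - by move=> v; rewrite U !inE => /andP[_ /lek].
have cardD u : u \in K -> #|K| = #|K :\ u|.+1.
  by move=> uK; rewrite (cardsD1 u) uK.
case: (pickP (fun q => d K q == 1)) => [q /eqP dq|noleaf].
  have [|p pK qp] := @degree_gt0P K q; first by rewrite -/(d K q) dq.
  have cKp := connectedD1_leaf thK cK pK qp dq.
  have [r [nrq Ep rp]] := thin_ends thK pK qp.
  have dq0 : d (K :\ p) q = 0.
    by have := degreeD1 q pK; rewrite dq qp addn1 => - [<-].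
  have sV : ends (K :\ p) \subset ends K :\ q.
    apply/subsetP=> z zV; rewrite !inE.
    have := subsetP (endsS (subsetDl K [set p])) z zV; rewrite inE => ->.
    rewrite andbT; apply: contraTneq zV => ->.
    by rewrite inE -/(d _ q) dq0.
  have leVp : #|ends K :\ q| <= #|K :\ p|.
    have := cardsD1 q (ends K); rewrite inE -/(d K q) dq /=.
    by have := cardD p pK; lia.
  case: (pickP (fun x => 2 < d (K :\ p) x)) => [x dx|small].
    apply: (step p) => //; last by exists x.
    exact: leq_trans (subset_leq_card sV) leVp.
  (* Now [K :\ p] is a cycle with the pendant edge [p] at [r]. The edge [u] of the cycle at [r] has
     three neighbors in [K], and [p] has only two. *)
  have thKp := thinS (subsetDl K [set p]) thK.
  have d2 : {in ends K :\ q, forall x, d (K :\ p) x = 2}.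
    by apply: degree_eq2 => // x; have := small x; lia.
  have dr : d (K :\ p) r = 2.
    by apply: d2; rewrite !inE nrq; apply: degree_gt0 rp.
  have [|u uKp ru] := @degree_gt0P (K :\ p) r; first by rewrite -/(d _ r) dr.
  have [y [nyr Eu yu]] := thin_ends thKp uKp ru.
  have uK : u \in K by have := uKp; rewrite !inE => /andP[].
  have nyq : y != q.
    apply: contraTneq (degree_gt0 uKp yu) => ->.
    by rewrite -/(d _ q) dq0.
  have dy : d K y = 2.
    rewrite (degreeD1 y pK) (in_ends2 _ Ep) (negPf nyq) (negPf nyr) addn0.
    by apply: d2; rewrite !inE nyq; apply: degree_gt0 yu.
  have dKr : d K r = 3 by rewrite (degreeD1 r pK) rp dr.
  have neq_pu : p != u by have := uKp; rewrite !inE eq_sym => /andP[].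
  have fpu : f p u by apply: (@conflictI r); rewrite // e_sym.
  apply: (@extends_uneven _ f k f_sym f_irr X K u p) => //.
  - have -> : K :\ u = p |: (K :\ p :\ u).
      by apply/setP=> z; rewrite !inE; case: (eqVneq z p) => //= ->; rewrite neq_pu.
    have cKpu : connected f (K :\ p :\ u).
      apply: connectedD1_even => // x; case: (boolP (x \in ends K :\ q)) => [/d2->//|].
      move=> xV; suff -> : d (K :\ p) x = 0 by [].
      apply/eqP; rewrite -leqn0 leqNgt; apply: contra xV => dx.
      by apply: (subsetP sV); rewrite inE.
    have := degreeD1 r uKp; rewrite dr ru addn1 => - [dr1].
    have [|a aK ra] := @degree_gt0P (K :\ p :\ u) r; first by rewrite -/(d _ r) -dr1.
    apply: (connectedU1 _ cKpu aK) => //; apply: (@conflictI r).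
    + by have := aK; rewrite !inE eq_sym => /and3P[].
    + by rewrite e_sym.
    + by rewrite e_sym.
  - by rewrite /f f_sym.
  have := line_degree thK pK _ Ep; rewrite eq_sym => /(_ nrq).
  have := line_degree thK uK _ Eu; rewrite eq_sym => /(_ nyr).
  rewrite dq dKr dy; move: #|nbrs_in f K u| #|nbrs_in f K p| => a b.
  by clear -a b; lia.
have [u uK cKu] := @connected_noncut _ f K f_sym cK (ltnW K2).
(* Without pendant edges all degrees are at least 2, and that of [x0] is larger. So removing an edge
   still leaves as many edges as vertices. *)
have ltV : #|ends K| < #|K|.
  have := handshake thK; rewrite -(sum_ends (subxx _)).
  have x0V : x0 \in ends K by rewrite inE; apply: leq_trans dx0.
  rewrite (bigD1 x0) //= => E.
  have : \sum_(x in ends K | x != x0) 2 <= \sum_(x in ends K | x != x0) d K x.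
    apply: leq_sum => x /andP[]; rewrite inE => dx _.
    by have := noleaf x; rewrite /= -/(d K x) in dx *; lia.
  rewrite sum_nat_cond_const; have -> : [set x in ends K | x != x0] = ends K :\ x0.
    by apply/setP=> x; rewrite !inE andbC.
  have := cardsD1 x0 (ends K); rewrite x0V; move: (dx0) E.
  move: (d K x0) (\sum_(x in _ | _) _) #|K| #|ends K| #|_ :\ _| => a b c v w.
  by clear -a b c v w; lia.
have sV : ends (K :\ u) \subset ends K by apply: endsS (subsetDl _ _).
have leVu : #|ends K| <= #|K :\ u| by have := cardD u uK; lia.
case: (pickP (fun x => 2 < d (K :\ u) x)) => [x dx|small].
  apply: (step u) => //; last by exists x.
  exact: leq_trans (subset_leq_card sV) leVu.
(* Now [u] is a chord of the cycle [K :\ u]. It has four neighbors in [K], and an edge [p] of the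
   cycle at its end [x] has three. *)
have thKu := thinS (subsetDl K [set u]) thK.
have d2 : {in ends K, forall x, d (K :\ u) x = 2}.
  by apply: degree_eq2 => // x; have := small x; lia.
have [Kdeg Kinj] := thK.
have /cards2P[x [y [nxy Eu]]] : #|N u| == 2 by rewrite -(Kdeg u uK).
have end3 z : e z u -> d K z = 3.
  move=> zu; rewrite (degreeD1 z uK) zu d2 // inE; exact: degree_gt0 zu.
have xu : e x u by rewrite (in_ends2 _ Eu) eqxx.
have yu : e y u by rewrite (in_ends2 _ Eu) eqxx orbT.
have [|p pKu xp] := @degree_gt0P (K :\ u) x.
  by rewrite -/(d _ x) d2 // inE; exact: degree_gt0 xu.
have [z [nzx Ep zp]] := thin_ends thKu pKu xp.
have [npu pK] : p != u /\ p \in K by have := pKu; rewrite !inE => /andP[].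
have nzy : z != y.
  apply: contraNneq npu => zy; apply/eqP/Kinj => //.
  by rewrite -/(N p) -/(N u) Ep Eu zy.
have fup : f u p by apply: (@conflictI x); rewrite 1?eq_sym // e_sym.
apply: (@extends_uneven _ f k f_sym f_irr X K u p) => //.
have dz : d K z = 2.
  rewrite (degreeD1 z uK) (in_ends2 _ Eu) (negPf nzx) (negPf nzy) addn0.
  by apply: d2; rewrite inE; apply: degree_gt0 zp.
have := line_degree thK pK _ Ep; rewrite eq_sym => /(_ nzx).
have := line_degree thK uK nxy Eu.
rewrite dz !end3 //; move: #|nbrs_in f K u| #|nbrs_in f K p| => a b.
by clear -a b; lia.
Qed.

(** A minimal part of [K] with more edges than vertices is connected, since otherwise one of two
    pieces would also have more, and by averaging it has a vertex of degree above 2. *)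
Lemma extends_dense k K (Y : {set T}) : thin K -> #|ends K| < #|K| -> K \subset Y ->
    {in K, forall u, #|nbrs_in f Y u| <= k} ->
  exists A, [/\ A \subset K, A != set0 & extends f k (Y :\: A) Y].
Proof.
move=> thK ltK sKY lek.
have [A /minsetP[ltA minA] sAK] :=
  @minset_exists _ [pred A : {set T} | #|ends A| < #|A|] K ltK.
have thA := thinS sAK thK.
exists A; split=> //; first by rewrite -card_gt0; apply: leq_trans ltA.
have U : (Y :\: A) :|: A = Y.
  by rewrite setUC -{1}(setIidPr (subset_trans sAK sKY)) setID.
rewrite -[X in extends _ _ _ X]U; apply: extends_cyclic => //.
- move=> B sBA B0 clB; apply: (minA) => //; rewrite inE ltnNge; apply/negP=> leB.
  have leAB : #|A :\: B| <= #|ends (A :\: B)|.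
    rewrite leqNgt; apply/negP=> /(minA (A :\: B)) /(_ (subsetDl _ _)) E.
    have /set0Pn[b bB] := B0; have := subsetP sBA b bB.
    by rewrite -E inE bB.
  suff : #|ends B| + #|ends (A :\: B)| <= #|ends A|.
    have E := cardsID B A; rewrite (setIidPr sBA) in E; rewrite inE in ltA.
    by move=> /(leq_trans (leq_add leB leAB)); rewrite E leqNgt ltA.
  have -> : #|ends B| + #|ends (A :\: B)| = #|ends B :|: ends (A :\: B)|.
    apply/esym/eqP; rewrite (leq_card_setU (ends B)).
    apply/pred0P=> x /=; apply/negP; rewrite !inE.
    case/andP=> /degree_gt0P[b bB xb] /degree_gt0P[a].
    rewrite inE => /andP[aB aA] xa; case/negP: (aB); apply: (clB b) => //.
    have nba : b != a by apply: contraNneq aB => <-.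
    by apply: (@conflictI x); rewrite // e_sym.
  by apply: subset_leq_card; rewrite subUset !endsS ?subsetDl.
- exact: ltnW.
- case: (pickP (fun x => 2 < d A x)) => [x|small]; first by exists x.
  have := handshake thA; rewrite -(sum_ends (subxx _)).
  have : \sum_(x in ends A) d A x <= \sum_(x in ends A) 2.
    by apply: leq_sum => x _; have := small x; lia.
  by rewrite sum_nat_const; rewrite inE in ltA; lia.
- by rewrite disjoints_subset; apply/subsetP=> z; rewrite !inE => /andP[].
- by move=> u uA; rewrite U; apply: lek; apply: (subsetP sAK).
Qed.

End LineGraph.

(** * Greedy recoloring and deletion of an edge *)

Lemma greedy_closure (T : finType) (f : rel T) k :
    symmetric f -> irreflexive f ->
  exists U : {set T}, extends f k (~: U) setT /\
    forall b, b \notin U -> k <= #|nbrs_in f (~: U) b|.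
Proof.
move=> f_sym f_irr.
(* [U] grows from the empty set; its vertices get recolored in the reverse order of their entry. *)
have : extends f k (~: set0) setT by rewrite setC0 => c pc; exists c.
have [n] := ubnP #|~: (set0 : {set T})|.
elim: n (set0 : {set T}) => // n IHn U leU extU.
case: (pickP (fun b => (b \notin U) && (#|nbrs_in f (~: U) b| < k))) => [b|big].
  case/andP=> bU ltk.
  have E : b |: ~: (b |: U) = ~: U.
    by apply/setP=> z; rewrite !inE; case: eqP => // ->.
  apply: (IHn (b |: U)).
    rewrite -ltnS; apply: leq_trans leU; rewrite ltnS.
    by rewrite -E cardsU1 !inE eqxx.
  apply: extends_trans extU; first by rewrite setCS subsetUr.
  rewrite -E; apply: extends1 => //; first by rewrite !inE eqxx.
  apply: leq_ltn_trans ltk; apply: card_nbrs_inS.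
  by rewrite setCS subsetUr.
exists U; split=> // b bU; rewrite leqNgt.
by have := big b; rewrite bU => /negbT.
Qed.

Lemma injective_colorableP (T : finType) (e : rel T) k :
  reflect (exists c : T -> 'I_k, proper_on (conflict e) c setT)
    (injective_colorable e k).
Proof.
apply: (iffP existsP) => [[c /forallP pc]|[c pc]].
  exists c => x y _ _; have /forallP/(_ y)/implyP := pc x; exact.
exists [ffun x => c x]; apply/forallP=> x; apply/forallP=> y; apply/implyP=> fxy.
by rewrite !ffunE; apply: pc.
Qed.

Definition delete_edge (T : finType) (e : rel T) (u v : T) : rel T :=
  fun x y => e x y && ([set x; y] != [set u; v]).

Lemma delete_edgeE (T : finType) (e : rel T) u v x y :
  e x y -> x != u -> x != v -> delete_edge e u v x y.
Proof.
rewrite /delete_edge => -> xu xv; apply: contraTneq isT => /setP/(_ x).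
by rewrite !inE eqxx (negPf xu) (negPf xv).
Qed.

(** A conflict destroyed by deleting the edge involves [u] or [v] itself. *)
Lemma proper_delete_edge (T : finType) (e : rel T) k (c : T -> 'I_k) X u v :
  proper_on (conflict (delete_edge e u v)) c X -> u \notin X -> v \notin X ->
  proper_on (conflict e) c X.
Proof.
move=> pc uX vX x y xX yX /conflictE[z [nxy xz yz]]; apply: pc => //.
have nX w : w \in X -> (w != u) /\ (w != v).
  by move=> wX; split; apply: contraTneq wX => ->.
have [[xu xv] [yu yv]] := (nX x xX, nX y yX).
by apply: (conflictI nxy (delete_edgeE xz xu xv) (delete_edgeE yz yu yv)).
Qed.

(** Two distinct vertices cannot meet at the pendant vertex [v], so a destroyed conflict involves
    [v], and [u] may keep its color. *)
Lemma proper_delete_pendant (T : finType) (e : rel T) k (c : T -> 'I_k) X u v :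
  (forall w, e w v -> w = u) ->
  proper_on (conflict (delete_edge e u v)) c X -> v \notin X ->
  proper_on (conflict e) c X.
Proof.
move=> only pc vX x y xX yX /conflictE[z [nxy xz yz]]; apply: pc => //.
have zv : z != v.
  by apply: contraNneq nxy => zE; rewrite zE in xz yz; rewrite (only x xz) (only y yz).
have nX w : w \in X -> e w z -> delete_edge e u v w z.
  move=> wX wz; rewrite /delete_edge wz; apply/negP=> /eqP/setP/(_ v).
  rewrite !inE eqxx orbT (eq_sym v z) (negPf zv) orbF => /eqP vE.
  by rewrite vE wX in vX.
by apply: conflictI nxy (nX x xX xz) (nX y yX yz).
Qed.

(** * Vertices of small degree in a critical graph *)

Section Critical.

Variables (T : finType) (e : rel T) (D : nat) (U : {set T}).
Hypothesis e_sym : symmetric e.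
Hypotheses (D_ge4 : 4 <= D) (le_D : forall x, degree e x <= D).
Hypothesis not_colorable : ~~ injective_colorable e (D + 2).
Hypothesis critical : forall u v,
  e u v -> injective_colorable (delete_edge e u v) (D + 2).
Hypothesis extends_U : extends (conflict e) (D + 2) (~: U) setT.
Hypothesis closed_U :
  forall b, b \notin U -> D + 2 <= #|nbrs_in (conflict e) (~: U) b|.

Let N x := [set w | e x w].

(** A coloring of the graph without the edge is kept on [X] only, where it is proper for [e] too,
    then extended to [~: U] and to all vertices. *)
Lemma irreducible (X : {set T}) u v : e u v -> u \notin X -> v \notin X ->
  X \subset ~: U -> extends (conflict e) (D + 2) X (~: U) -> False.
Proof.
move=> uv uX vX sXU eX; have /injective_colorableP[c pc] := critical uv.
have [c' pc' _] := extends_trans sXU eX extends_U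
  (proper_delete_edge (proper_onS (subsetT X) pc) uX vX).
by case/injective_colorableP: not_colorable; exists c'.
Qed.

Lemma independent_U u v : e u v -> u \in U -> v \notin U.
Proof.
move=> uv uU; apply/negP=> vU; apply: (irreducible uv _ _ (subxx _)).
- by rewrite inE uU.
- by rewrite inE vU.
- by move=> c pc; exists c.
Qed.

(** The conflicts of [b] through its neighbor [x] with vertices outside [U]; their sum over [x]
    bounds what [closed_U] counts. *)
Definition load x b := #|(N x :\ b) :\: U|.

Lemma conflicts_le_load b :
  #|nbrs_in (conflict e) (~: U) b| <= \sum_(x in N b) load x b.
Proof.
have sub : nbrs_in (conflict e) (~: U) b
    \subset \bigcup_(x in N b) ((N x :\ b) :\: U).
  apply/subsetP=> y; rewrite !inE => /andP[yU /conflictE[z [nby bz yz]]].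
  by apply/bigcupP; exists z; rewrite !inE // yU eq_sym nby e_sym.
apply: leq_trans (subset_leq_card sub) _; rewrite /load.
elim/big_rec2: _ => [|x m A _ leA]; first by rewrite cards0.
by apply: leq_trans (leq_card_setU _ _).1 _; rewrite leq_add2l.
Qed.

Lemma mem_U b : \sum_(x in N b) load x b < D + 2 -> b \in U.
Proof.
apply: contraTT => bU; rewrite -leqNgt.
exact: leq_trans (closed_U bU) (conflicts_le_load b).
Qed.

Lemma load_le x b : e x b -> load x b <= (degree e x).-1.
Proof.
move=> xb; rewrite /degree (cardsD1 b) inE xb /=.
by apply: subset_leq_card; apply: subsetDl.
Qed.

Lemma load_le_U x b t : e x b -> e x t -> t != b -> t \in U ->
  load x b <= (degree e x).-2.
Proof.
move=> xb xt tb tU; rewrite /degree (cardsD1 b) inE xb (cardsD1 t) !inE xt tb /=.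
apply: subset_leq_card; apply/subsetP=> z; rewrite !inE => /andP[zU ->].
by rewrite andbT; apply: contraNneq zU => ->.
Qed.

Lemma load_le_D x b : e x b -> load x b <= D.-1.
Proof. by move=> /load_le/leq_trans; apply; have := le_D x; lia. Qed.

Lemma sum_load_le b l (L : {set T}) : L \subset N b ->
    \sum_(x in L) load x b <= l ->
  \sum_(x in N b) load x b <= l + (degree e b - #|L|) * D.-1.
Proof.
move=> sL leL; rewrite (bigID (mem L)) /=; apply: leq_add.
  rewrite (eq_bigl (mem L)) // => x /=; apply: andb_idl; exact: (subsetP sL).
rewrite (_ : degree e b - #|L| = #|N b :\: L|); last first.
  by rewrite cardsD (setIidPr sL).
rewrite -sum_nat_const (eq_bigl (mem (N b :\: L))); last first.
  by move=> x; rewrite /= [RHS]inE andbC.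
by apply: leq_sum => x; rewrite !inE e_sym => /andP[_ /load_le_D].
Qed.

(** A pendant vertex has at most [D - 1] conflicts and so lies in [U]. Its neighbor need not, hence
    the appeal to [proper_delete_pendant]. *)
Lemma degree_neq1 v : degree e v != 1.
Proof.
apply/negP=> /cards1P[u Nv].
have vu : e v u by have := set11 u; rewrite -Nv inE.
have only w : e w v -> w = u by rewrite e_sym => vw; apply/set1P; rewrite -Nv inE.
have vU : v \in U.
  apply: mem_U; rewrite /N Nv big_set1; have := load_le_D (b := v) (x := u).
  by rewrite e_sym vu => /(_ isT); lia.
have uv : e u v by rewrite e_sym.
have /injective_colorableP[c pc] := critical uv.
have [|c' pc' _] := extends_U (proper_delete_pendant only
   (proper_onS (subsetT (~: U)) pc) _); first by rewrite inE vU.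
by case/injective_colorableP: not_colorable; exists c'.
Qed.

(** At most 2 conflicts pass through [x] and [D - 1] through the other neighbor. *)
Lemma mem_U2 u x : degree e u = 2 -> e u x -> degree e x <= 3 -> u \in U.
Proof.
move=> du ux dx; apply: mem_U.
have sx : [set x] \subset N u by rewrite sub1set inE.
have xu : e x u by rewrite e_sym.
have := @sum_load_le u 2 [set x] sx; rewrite big_set1 cards1 du mul1n.
move=> /(_ _)/leq_ltn_trans; apply; last by lia.
by apply: leq_trans (load_le xu) _; lia.
Qed.

Lemma degree2_nbr u x : degree e u = 2 -> e u x -> 3 <= degree e x.
Proof.
move=> du ux; rewrite leqNgt; apply/negP=> dx; have xu : e x u by rewrite e_sym.
have dx2 : degree e x = 2.
  have : 0 < degree e x by apply/card_gt0P; exists u; rewrite inE.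
  by have := degree_neq1 x; lia.
have uU : u \in U by apply: (mem_U2 du ux); lia.
have xU : x \in U by apply: (mem_U2 dx2 xu); rewrite du.
by have := independent_U ux uU; rewrite xU.
Qed.

Definition needy x :=
  (degree e x == 3) && [exists t, e x t && (degree e t == 2)].

Definition nbrs2 v := [set x in N v | degree e x == 2].
Definition needy_nbrs v := [set x in N v | needy x].

(** The neighbor of [x] of degree 2 lies in [U] and differs from [b], so at most one neighbor of [x]
    is left to count. *)
Lemma needy_load x b : needy x -> e x b -> degree e b != 2 -> load x b <= 1.
Proof.
case/andP=> /eqP dx /existsP[t /andP[xt /eqP dt]] xb db.
have tx : e t x by rewrite e_sym.
have tU : t \in U by apply: (mem_U2 dt tx); rewrite dx.
have tb : t != b by apply: contraNneq db => <-; rewrite dt.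
by apply: leq_trans (load_le_U xb xt tb tU) _; rewrite dx.
Qed.

Lemma card_light v :
  #|nbrs2 v :|: needy_nbrs v| = #|nbrs2 v| + #|needy_nbrs v|.
Proof.
apply/eqP; rewrite (leq_card_setU (nbrs2 v)).
apply/pred0P=> x /=; rewrite !inE /needy.
by case: (e v x) => //=; case: eqP => // ->.
Qed.

Lemma sub_light v : nbrs2 v :|: needy_nbrs v \subset N v.
Proof. by apply/subsetP=> x; rewrite !inE => /orP[]/andP[]. Qed.

Lemma card_light_le v : #|nbrs2 v| + #|needy_nbrs v| <= degree e v.
Proof. by rewrite -card_light; apply: subset_leq_card (sub_light v). Qed.

Lemma light_load v x :
  degree e v != 2 -> x \in nbrs2 v :|: needy_nbrs v -> load x v <= 1.
Proof.
move=> dv; rewrite !inE (e_sym v) => /orP[]/andP[xv].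
  by move=> /eqP dx; apply: leq_trans (load_le xv) _; rewrite dx.
by move=> nx; apply: needy_load.
Qed.

Lemma mem_U_light v : degree e v != 2 ->
  let l := #|nbrs2 v| + #|needy_nbrs v| in
  l + (degree e v - l) * D.-1 < D + 2 -> v \in U.
Proof.
move=> dv l ltl; apply: mem_U; apply: leq_ltn_trans ltl.
rewrite /l -card_light; apply: sum_load_le; first exact: sub_light.
by rewrite -sum1_card; apply: leq_sum => x; apply: light_load.
Qed.

(** * The graph [M] with edge set [S] *)

Definition slack_nbrs :=
  [set u | [&& u \notin U, degree e u == 2 &
            [exists v, [&& e u v, v \in U & degree e v == 4]]]].

Local Notation S := slack_nbrs.

Lemma slack_nbrsP u : u \in S -> [/\ u \notin U, degree e u = 2 &
  exists v, [/\ e u v, v \in U & degree e v = 4]].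
Proof.
rewrite inE => /and3P[uU /eqP du /existsP[v /and3P[uv vU /eqP dv]]].
by split=> //; exists v.
Qed.

(** At most 3 conflicts pass through the neighbor of degree 4 and [D - 1] through the other one. *)
Lemma slack_nbrs_conflicts u :
  u \in S -> #|nbrs_in (conflict e) (~: U) u| <= D + 2.
Proof.
case/slack_nbrsP=> _ du [v [uv _ dv]]; have vu : e v u by rewrite e_sym.
apply: leq_trans (conflicts_le_load u) _.
have sv : [set v] \subset N u by rewrite sub1set inE.
have := @sum_load_le u 3 [set v] sv; rewrite big_set1 cards1 du mul1n.
move=> /(_ _)/leq_trans; apply; last by lia.
by apply: leq_trans (load_le vu) _; rewrite dv.
Qed.

(** If [u] and [v] had the same neighbors, [v] would be counted both among the 3 conflicts of [u]
    through [a] and among the at most [D - 1] through [b]. This leaves at most [D + 1], which puts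
    [u] in [U]. *)
Lemma thin_slack_nbrs : thin e S.
Proof.
split=> [u /slack_nbrsP[]//|u v /slack_nbrsP[uU du [a [ua aU da]]] _ Nuv].
have au : e a u by rewrite e_sym.
have [b [nba Eu bu]] := degree2_ends e_sym du au.
have va : e a v by have : a \in N v; [rewrite /N -Nuv inE|rewrite inE e_sym].
have vb : e b v by have : b \in N v; [rewrite /N -Nuv inE e_sym|rewrite inE e_sym].
apply/eqP; apply: contraNT uU => nuv; rewrite -[_ \in _]negbK.
apply/negP=> /closed_U; apply/negP; rewrite -ltnNge.
have sub : nbrs_in (conflict e) (~: U) u \subset (N a :\ u) :|: (N b :\ u).
  apply/subsetP=> y; rewrite !inE => /andP[_ /conflictE[z [nuy uz yz]]].
  have : z \in [set a; b] by rewrite -Eu inE.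
  rewrite eq_sym in nuy.
  by case/set2P=> <-; rewrite nuy (e_sym z) yz ?orbT.
have ca : #|N a :\ u| = 3.
  by move: da; rewrite /degree (cardsD1 u) inE au => -[].
have cb : #|N b :\ u| < D.
  by have := le_D b; rewrite /degree (cardsD1 u) inE bu.
have cab : 0 < #|(N a :\ u) :&: (N b :\ u)|.
  by apply/card_gt0P; exists v; rewrite !inE va vb eq_sym nuv.
apply: leq_ltn_trans (subset_leq_card sub) _.
have := cardsUI (N a :\ u) (N b :\ u); rewrite ca.
by move: cb cab; move: #|_| #|_| #|_| => x y z; clear -x y z; lia.
Qed.

(** [ends e S] is the vertex set of [M]. If [M] had more edges than vertices, some part [A] of [S]
    could be left uncolored with [U]; a member of [A] has a neighbor in [U], and the edge between
    them contradicts [irreducible]. *)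
Lemma few_slack_nbrs : #|S| <= #|ends e S|.
Proof.
rewrite leqNgt; apply/negP=> lt_S.
have sSU : S \subset ~: U by apply/subsetP=> u /slack_nbrsP[]; rewrite inE.
have [A [sAS /set0Pn[u uA] extA]] :=
  extends_dense e_sym thin_slack_nbrs lt_S sSU slack_nbrs_conflicts.
have [_ _ [v [uv vU _]]] := slack_nbrsP (subsetP sAS u uA).
apply: (irreducible uv _ _ _ extA); rewrite ?subsetDl // !inE ?uA //.
by rewrite vU andbF.
Qed.

(** * Discharging *)

Definition give v w : nat :=
  2 * (degree e w == 2) + (4 <= degree e v) * needy w.

Lemma sum_give v : \sum_(w in N v) give v w =
  2 * #|nbrs2 v| + (4 <= degree e v) * #|needy_nbrs v|.
Proof.
have count (P : pred T) : \sum_(w in N v) P w = #|[set w in N v | P w]|.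
  by rewrite -sum1dep_card big_mkcondr; apply: eq_bigr => w _; case: (P w).
by rewrite big_split /= -!big_distrr /= !count.
Qed.

Lemma slack_nbrs_sub v : nbrs_in e S v \subset nbrs2 v.
Proof.
by apply/subsetP=> u; rewrite inE => /andP[/slack_nbrsP[_ du _] vu]; rewrite !inE vu du.
Qed.

Lemma slack_degree_le v : #|nbrs_in e S v| <= #|nbrs2 v|.
Proof. exact: subset_leq_card (slack_nbrs_sub v). Qed.

Lemma slack_degree_small v : degree e v <= 3 -> #|nbrs_in e S v| = 0.
Proof.
move=> dv; apply/eqP; rewrite cards_eq0 -subset0; apply/subsetP=> u.
rewrite inE => /andP[/slack_nbrsP[uU du _] vu]; case/negP: uU.
by apply: (mem_U2 du _ dv); rewrite e_sym.
Qed.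

Lemma slack_degree4 v : degree e v = 4 -> v \in U ->
  #|nbrs_in e S v| = #|nbrs2 v|.
Proof.
move=> dv vU; apply/eq_card=> u; rewrite [LHS]inE [RHS]inE [u \in N v]inE andbC.
apply: andb_id2l => vu; rewrite inE (independent_U vu vU) /=.
by apply: andb_idr => _; apply/existsP; exists v; rewrite e_sym vu vU dv.
Qed.

(** If some [u] in [S] were adjacent to [v], its other neighbor would lie in [U], so [u] would have
    load 0. The remaining loads are at most 1, 1 and [D - 1], which puts [v] in [U]. *)
Lemma slack_degree3 v : degree e v = 4 -> v \notin U -> #|nbrs2 v| = 3 ->
  #|nbrs_in e S v| = 0.
Proof.
move=> dv vU c3; apply/eqP; rewrite cards_eq0 -subset0; apply/subsetP=> u.
rewrite inE => /andP[/slack_nbrsP[_ du [w [uw wU _]]] vu].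
case/negP: (vU); have uv : e u v by rewrite e_sym.
have uN : u \in nbrs2 v by rewrite !inE vu du.
apply: mem_U; have sN : nbrs2 v \subset N v.
  by apply/subsetP=> x; rewrite inE => /andP[].
have := @sum_load_le v 2 _ sN; rewrite c3 dv mul1n.
move=> /(_ _)/leq_ltn_trans; apply; last by lia.
rewrite (bigD1 u) //= (_ : 2 = 0 + #|nbrs2 v :\ u|); last first.
  by have := cardsD1 u (nbrs2 v); rewrite uN c3 => -[<-].
apply: leq_add.
  have wv : w != v by apply: contraNneq vU => <-.
  by apply: leq_trans (load_le_U uv uw wv wU) _; rewrite du.
rewrite -sum1_card (eq_bigl (mem (nbrs2 v :\ u))); last first.
  by move=> x; rewrite /= [RHS]inE andbC inE.
apply: leq_sum => x; rewrite !inE => /and3P[_ vx /eqP dx].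
by rewrite e_sym in vx; apply: leq_trans (load_le vx) _; rewrite dx.
Qed.

(** Without a neighbor of degree at least 4, the loads around [v] are at most 1, 2 and 2, and
    [D_ge4] puts [v] in [U] next to its neighbor [t], which is there already. *)
Lemma give_ge1 v : needy v -> 1 <= \sum_(w in N v) give w v.
Proof.
move=> nv; have /andP[/eqP dv /existsP[t /andP[vt /eqP dt]]] := nv.
have [/exists_inP[w vw dw]|none] := boolP [exists w in N v, 4 <= degree e w].
  by rewrite (bigD1 w) //= {1}/give dw nv mul1n addn1 addSn.
have tU : t \in U by apply: (mem_U2 dt (x := v)); rewrite ?dv // e_sym.
have tv : e t v by rewrite e_sym.
case/negP: (independent_U tv tU); apply: mem_U.
have st : [set t] \subset N v by rewrite sub1set inE.
have le2 x : x \in N v -> load x v <= 2.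
  rewrite inE e_sym => xv; apply: leq_trans (load_le xv) _.
  have := none; rewrite negb_exists_in => /forall_inP/(_ x).
  by rewrite inE e_sym => /(_ xv); case: (degree e x) => [|[|[|[|]]]].
rewrite (bigD1 t) ?inE //=.
have : load t v <= 1 by apply: leq_trans (load_le tv) _; rewrite dt.
have : \sum_(x in N v | x != t) load x v <= \sum_(x in N v | x != t) 2.
  by apply: leq_sum => x /andP[/le2].
rewrite sum_nat_cond_const (_ : [set x in N v | x != t] = N v :\ t); last first.
  by apply/setP=> x; rewrite !inE andbC.
have : #|N v :\ t| = 2.
  by move: dv; rewrite /degree (cardsD1 t) inE vt => -[].
by move=> ->; move: (load t v) (\sum_(x in _ | _) _) => a b; move: D_ge4; clear; lia.
Qed.

(** The final charge is nonnegative, with the subtractions moved across to stay in [nat]; isolated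
    vertices are exempt from the cost 14. *)
Lemma discharge v :
  14 * (0 < degree e v) + \sum_(w in N v) give v w + 2 * (v \in ends e S) <=
  5 * degree e v + \sum_(w in N v) give w v + #|nbrs_in e S v|.
Proof.
rewrite sum_give inE.
have := card_light_le v; have := slack_degree_le v.
have := degree_neq1 v; have light := @mem_U_light v.
case dv: (degree e v) => [|[|[|[|[|d]]]]] _ //=.
- by move: #|_| #|_| #|_| => s j n; clear; lia.
(* Degree 2: the deficit [14 - 10] is paid by the two neighbors, and no neighbor has degree 2. *)
- have j0 : #|nbrs2 v| = 0.
    apply/eqP; rewrite cards_eq0 -subset0; apply/subsetP=> x.
    by rewrite !inE => /andP[/(degree2_nbr dv) + /eqP dx]; rewrite dx.
  have : 4 <= \sum_(w in N v) give w v.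
    have -> : 4 = \sum_(w in N v) 2 by rewrite sum_nat_const -/(degree e v) dv.
    by apply: leq_sum => w _; rewrite /give dv.
  rewrite j0; move: #|_| #|_| (\sum_(_ in _) _) => s n t; clear; lia.
(* Degree 3: two neighbors of degree 2 would put [v] in [U] beside them; a single one is paid by
   [15 - 14] and the 1 received. *)
- rewrite slack_degree_small ?dv //.
  have [->|j0] := posnP #|nbrs2 v|; first by clear; lia.
  have nv : needy v.
    rewrite /needy dv; case/card_gt0P: j0 => t; rewrite !inE => vt.
    by apply/existsP; exists t.
  have j1 : #|nbrs2 v| <= 1.
    rewrite leqNgt; apply/negP=> j2.
    have vU : v \in U.
      apply: light; rewrite dv //=; have := card_light_le v; rewrite dv.
      move: #|nbrs2 v| j2 #|needy_nbrs v| D_ge4 => j; clear; move=> j2 n.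
      case: (j + n) (leq_trans j2 (leq_addr n j)) => [|[|[|[|l]]]] //= _; lia.
    case/card_gt0P: j0 => t; rewrite !inE => /andP[vt /eqP dt].
    have tv : e t v by rewrite e_sym.
    by have := independent_U tv (mem_U2 dt tv _); rewrite dv vU => /(_ isT).
  have := give_ge1 nv; move: (\sum_(_ in _) _) #|needy_nbrs v| #|nbrs2 v| j1.
  by clear; lia.
(* Degree 4: the spare charge is 6. In [U], being in [M] costs 2 but returns 1 for each neighbor of
   degree 2. Outside [U], at most three neighbors are needy or of degree 2. If all three have degree
   2, [v] is not in [M]; otherwise [v] sends at most 5 and loses at most 1 to [M]. *)
- have [vU|vU] := boolP (v \in U).
    rewrite slack_degree4 //; move: #|_| #|_| (\sum_(_ in _) _) => j n i.
    by clear; lia.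
  have l3 : #|nbrs2 v| + #|needy_nbrs v| <= 3.
    rewrite leqNgt; apply: contra vU => l4; apply: light; rewrite dv //=.
    have -> : #|nbrs2 v| + #|needy_nbrs v| = 4.
      by apply/eqP; rewrite eqn_leq l4 -[X in _ <= X]dv card_light_le.
    by rewrite subnn; move: D_ge4; clear; lia.
  have := slack_degree3 dv vU; move: l3.
  by move: #|_| #|_| #|_| (\sum_(_ in _) _) => j n s i; clear; lia.
(* Degree [n >= 5]: at least [3 n - 14 >= 1] remains, and being in [M] costs at most 1. *)
by move: #|_| #|_| #|_| (\sum_(_ in _) _) => s j n i; clear; lia.
Qed.

(** In the sum over all vertices the transfers cancel, and [M] contributes
    [2 * #|S| - 2 * #|ends e S|], which is not positive. *)
Lemma critical_dense :
  14 * #|[set x | 0 < degree e x]| <= 5 * \sum_x degree e x.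
Proof.
have E : \sum_v \sum_(w in N v) give w v = \sum_v \sum_(w in N v) give v w.
  rewrite (exchange_big_dep predT) //=; apply: eq_bigr => v _.
  by apply: eq_bigl => w; rewrite !inE e_sym.
have split3 (a b c : nat) (F G H : T -> nat) :
    \sum_v (a * F v + b * G v + c * H v) =
    a * \sum_v F v + b * \sum_v G v + c * \sum_v H v.
  by rewrite !big_distrr -!big_split.
have : \sum_v (14 * (0 < degree e v) + 1 * \sum_(w in N v) give v w +
               2 * (v \in ends e S)) <=
       \sum_v (5 * degree e v + 1 * \sum_(w in N v) give w v +
               1 * #|nbrs_in e S v|).
  by apply: leq_sum => v _; rewrite !mul1n; apply: discharge.
rewrite !split3 E.
have card_sum (P : pred T) : \sum_v P v = #|[set x | P x]|.
  by rewrite -sum1dep_card [RHS]big_mkcond; apply: eq_bigr => w _; case: (P w).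
rewrite !card_sum (handshake e_sym thin_slack_nbrs).
have -> : [set x in ends e S] = ends e S by apply/setP=> x; rewrite inE.
have := few_slack_nbrs; move: #|_| #|_| #|_| (\sum_(_ : T) degree e _).
by move: (\sum_(_ : T) _) => a b c d g; clear; lia.
Qed.

End Critical.

(** * From the maximum average degree to degree sums, and the minimal counterexample *)

Definition sparse (T : finType) (e : rel T) := forall X : {set T}, X != set0 ->
  5 * \sum_(x in X) #|nbrs_in e X x| < 14 * #|X|.

(** Sending [y] to [[set x; y]] is injective into the edges at [x], and an edge has at most two
    ends. *)
Lemma sum_degree_le (T : finType) (e : rel T) (X : {set T}) :
  \sum_(x in X) #|nbrs_in e X x| <= 2 * #|[set g in edges e | g \subset X]|.
Proof.
set E := [set g in _ | _].
apply: (@leq_trans (\sum_(x in X) #|[set g in E | x \in g]|)).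
  apply: leq_sum => x xX.
  have inj : {in nbrs_in e X x &, injective (fun y => [set x; y])}.
    move=> y z _ _ /setP eq_yz; have := eq_yz z; have := eq_yz y.
    rewrite !inE !eqxx !orbT; case: (eqVneq y x) => [->|_] /=; last by move/esym/eqP.
    by move=> _ /orP[]/eqP.
  rewrite -(card_in_imset inj); apply: subset_leq_card.
  apply/subsetP=> _ /imsetP[y + ->]; rewrite !inE => /andP[yX xy].
  rewrite eqxx andbT subUset !sub1set xX yX !andbT.
  by apply/imset2P; exists x y; rewrite // !inE.
under eq_bigr do rewrite -sum1_card.
rewrite (exchange_big_dep (mem E)) /=; last by move=> x g _; rewrite inE => /andP[].
rewrite mulnC -sum_nat_const; apply: leq_sum => g gE.
rewrite sum1dep_card; apply: (@leq_trans #|g|).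
  by apply: subset_leq_card; apply/subsetP=> x; rewrite !inE => /and3P[].
move: gE; rewrite inE => /andP[/imset2P[x y _ _ ->] _].
by rewrite cards2; case: (x != y).
Qed.

Lemma sparse_of_mad (T : finType) (e : rel T) :
  (mad e < 14%:R / 5%:R)%R -> sparse e.
Proof.
move=> lt_mad X X0; have X_gt0 : 0 < #|X| by rewrite card_gt0.
apply: leq_ltn_trans (leq_mul (leqnn 5) (sum_degree_le e X)) _.
set E := [set g in _ | _].
have sub : is_subgraph e (X, E) && (X != set0).
  rewrite X0 andbT; apply/andP; split.
    by apply/subsetP=> g; rewrite inE => /andP[].
  by apply/forall_inP=> g; rewrite inE => /andP[].
have := le_lt_trans (le_bigmax_cond 0%R (@average_degree T) sub) lt_mad.
rewrite /average_degree /= ltr_pdivrMr ?ltr0n //.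
rewrite mulrAC ltr_pdivlMr ?ltr0n // -!natrM ltr_nat.
by rewrite mulnC.
Qed.

Lemma sparse_sub (T : finType) (e e' : rel T) : subrel e' e -> sparse e -> sparse e'.
Proof.
move=> sub sp X X0; apply: leq_ltn_trans (sp X X0); rewrite leq_mul2l /=.
apply: leq_sum => x _; apply: subset_leq_card; apply/subsetP=> y.
by rewrite !inE => /andP[->] /sub.
Qed.

(** [D] is a bound rather than the maximum degree, so that it survives the deletion of an edge in
    the induction. *)
Lemma sparse_injective_colorable (T : finType) (e : rel T) D :
    symmetric e -> 4 <= D -> (forall x, degree e x <= D) -> sparse e ->
  injective_colorable e (D + 2).
Proof.
have [n] := ubnP #|[set p | e p.1 p.2]|.
elim: n e => // n IHn e lt_n e_sym D_ge4 le_D sp.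
case: (boolP (injective_colorable e (D + 2))) => // not_col.
have critical u v : e u v -> injective_colorable (delete_edge e u v) (D + 2).
  move=> uv; have sub : subrel (delete_edge e u v) e by move=> x y /andP[].
  apply: IHn => //.
  - rewrite -ltnS; apply: leq_trans lt_n; rewrite ltnS.
    apply: proper_card; apply/properP; split.
      by apply/subsetP=> p; rewrite !inE => /sub.
    by exists (u, v); rewrite !inE // /delete_edge eqxx andbF.
  - by move=> x y; rewrite /delete_edge e_sym setUC.
  - move=> x; apply: leq_trans (le_D x); apply: subset_leq_card.
    by apply/subsetP=> y; rewrite !inE => /sub.
  - exact: sparse_sub sp.
have [U [extU closedU]] :=
  greedy_closure (D + 2) (conflict_sym e) (conflict_irr e).
have dense := critical_dense e_sym D_ge4 le_D not_col critical extU closedU.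
(* [sparse] is applied to the non-isolated vertices, which keep their full degree in the subgraph
   they induce. If there are none, a constant coloring works. *)
set X := [set x | 0 < degree e x] in dense.
have XP x y : e x y -> y \in X.
  by move=> xy; rewrite inE; apply/card_gt0P; exists x; rewrite inE e_sym.
have [X0|/sp] := eqVneq X set0.
  case/injective_colorableP: not_col.
  have D2 : 0 < D + 2 by rewrite addn2.
  exists (fun=> Ordinal D2) => x y _ _ /conflictE[z [_ /XP]].
  by rewrite X0 inE.
suff -> : \sum_(x in X) #|nbrs_in e X x| = \sum_x degree e x.
  by rewrite ltnNge dense.
rewrite [RHS](bigID (mem X)) /= [X in _ = _ + X]big1 => [|x].
  rewrite addn0; apply: eq_bigr => x _; apply: eq_card => y; rewrite !inE.
  by apply: andb_idl => /XP; rewrite inE.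
by rewrite inE -eqn0Ngt => /eqP.
Qed.

Theorem theorem1 (T : finType) (e : rel T)
    (e_sym : symmetric e) (e_irr : irreflexive e) :
  4 <= max_degree e ->
  (mad e < 14%:R / 5%:R)%R ->
  injective_chromatic_number e <= max_degree e + 2.
Proof.
move=> D_ge4 /sparse_of_mad sp; rewrite /injective_chromatic_number.
case: ex_minnP => m _; apply; apply: sparse_injective_colorable => // x.
exact: (@leq_bigmax _ (degree e)).
Qed.
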